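(* Let $\Gamma=(\gamma_{ij})$ be a skew-symmetric $n\times n$ matrix over $\mathbf{k}$ and let $P=(p_1,\dots,p_n),Q=(q_1,\dots,q_n)\in\mathbf{k}^n$ with $p_i\ne q_i$ for all $i$. Then every $K$-prime Poisson ideal of $A_n=A_{n,\Gamma}^{P,Q}$ is generated (as an ideal) by an admissible set.
   Context: $\mathbf{k}$ is an algebraically closed field of characteristic zero. A Poisson algebra is a commutative $\mathbf{k}$-algebra with a $\mathbf{k}$-bilinear Lie bracket $\{\cdot,\cdot\}$ satisfying $\{ab,c\}=a\{b,c\}+b\{a,c\}$; a Poisson ideal is an ideal $I$ with $\{I,A\}\subseteq I$. $A_n=A_{n,\Gamma}^{P,Q}$ is the polynomial ring $\mathbf{k}[y_1,x_1,\dots,y_n,x_n]$ with the Poisson bracket determined by $\{y_i,y_j\}=\gamma_{ij}y_iy_j$ (all $i,j$); $\{x_i,y_j\}=(p_j-\gamma_{ij})y_jx_i$ ($i<j$); $\{y_i,x_j\}=-(q_i+\gamma_{ij})y_ix_j$ ($i<j$); $\{x_i,x_j\}=(q_i-p_j+\gamma_{ij})x_ix_j$ ($i<j$); $\{x_i,y_i\}=q_iy_ix_i+\sum_{k=1}^{i-1}(q_k-p_k)y_kx_k$ (all $i$). Put $\Omega_i=\sum_{k=1}^i(q_k-p_k)y_kx_k$ for $i=1,\dots,n$ and $\mathcal P_n=\{\Omega_1,y_1,x_1,\dots,\Omega_n,y_n,x_n\}$. A subset $T\subseteq\mathcal P_n$ is admissible if (a) for $2\le i\le n$: ($y_i\in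 T$ or $x_i\in T$) $\Leftrightarrow$ ($\Omega_i\in T$ and $\Omega_{i-1}\in T$); (b) ($y_1\in T$ or $x_1\in T$) $\Leftrightarrow$ $\Omega_1\in T$. $K=\{(h_1,\dots,h_{2n})\in\mathbf{k}^{2n}: h_{2i-1}+h_{2i}=h_{2j-1}+h_{2j}\text{ for all }i,j\}$ is an additive group acting on $A_n$ by Poisson derivations via $(h_1,\dots,h_{2n})(f)=\sum_{i}\left(h_{2i-1}y_i\frac{\partial f}{\partial y_i}+h_{2i}x_i\frac{\partial f}{\partial x_i}\right)$. A proper Poisson ideal $Q'$ is a $K$-prime Poisson ideal if it is $K$-stable and whenever $I,J$ are $K$-stable Poisson ideals with $IJ\subseteq Q'$, then $I\subseteq Q'$ or $J\subseteq Q'$. *)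

(* Defs.v *)
From mathcomp Require Import all_boot all_order all_algebra.
From mathcomp Require Import mpoly.
From mathcomp Require Import ring.

Set Implicit Arguments.
Unset Strict Implicit.
Unset Printing Implicit Defensive.

Import GRing.Theory.
Local Open Scope ring_scope.

Section Ideals.
Variable A : comNzRingType.
Implicit Types (I J T : A -> Prop) (br : A -> A -> A).

Record is_ideal I : Prop := IsIdeal {
  ideal0 : I 0;
  idealD : forall f g, I f -> I g -> I (f + g);
  idealM : forall f g, I g -> I (f * g) }.

Definition ideal_gen T (f : A) : Prop :=
  exists s : seq (A * A),
    (forall u, u \in s -> T u.2) /\ f = \sum_(u <- s) u.1 * u.2.

Definition ideal_prod I J : A -> Prop :=
  ideal_gen (fun f => exists a b, [/\ I a, J b & f = a * b]).

Definition poisson_ideal br I : Prop :=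
  is_ideal I /\ forall f g, I f -> I (br f g).

End Ideals.

Record is_poisson_bracket (k : fieldType) (A : comAlgType k)
    (br : A -> A -> A) : Prop := IsPoissonBracket {
  pb_linearl : forall (c : k) f g h, br (c *: f + g) h = c *: br f h + br g h;
  pb_linearr : forall (c : k) f g h, br h (c *: f + g) = c *: br h f + br h g;
  pb_alt : forall f, br f f = 0;
  pb_jacobi : forall f g h,
    br f (br g h) + br g (br h f) + br h (br f g) = 0;
  pb_leibniz : forall f g h, br (f * g) h = f * br g h + g * br f h }.

Section PoissonAlgebra.
Variables (k : fieldType) (n : nat).
Variables (Gamma : 'M[k]_n) (P Q : 'rV[k]_n).

(* Indices are 0-based, and the 2n variables are ordered as
   y_0, ..., y_(n-1), x_0, ..., x_(n-1) instead of being interleaved; the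
   components of elements of K are ordered accordingly. *)
Local Notation A := {mpoly k[n + n]}.

Definition yv (i : 'I_n) : A := 'X_(lshift n i).
Definition xv (i : 'I_n) : A := 'X_(rshift n i).

Definition Omega (i : 'I_n) : A :=
  \sum_(l < n | (l <= i)%N) (Q 0 l - P 0 l) *: (yv l * xv l).

(* {x_i, y_j}; for j < i this is minus the defining value of {y_j, x_i}. *)
Definition bracket_xy (i j : 'I_n) : A :=
  if (i < j)%N then (P 0 j - Gamma i j) *: (yv j * xv i)
  else if (j < i)%N then (Q 0 j + Gamma j i) *: (yv j * xv i)
  else Q 0 i *: (yv i * xv i)
       + \sum_(l < n | (l < i)%N) (Q 0 l - P 0 l) *: (yv l * xv l).

Definition bracket_xx (i j : 'I_n) : A :=
  if (i < j)%N then (Q 0 i - P 0 j + Gamma i j) *: (xv i * xv j)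
  else if (j < i)%N then - ((Q 0 j - P 0 i + Gamma j i) *: (xv j * xv i))
  else 0.

Definition bracket_var (a b : 'I_(n + n)) : A :=
  match split a, split b with
  | inl i, inl j => Gamma i j *: (yv i * yv j)
  | inr i, inl j => bracket_xy i j
  | inl i, inr j => - bracket_xy j i
  | inr i, inr j => bracket_xx i j
  end.

(* The biderivation determined by its values on the variables; when Gamma is
   skew-symmetric it is the unique Poisson bracket with the prescribed values
   (bracket_poisson and bracket_unique below). *)
Definition bracket (f g : A) : A :=
  \sum_a \sum_b f^`M(a) * g^`M(b) * bracket_var a b.

Definition calP (f : A) : Prop :=
  exists i : 'I_n, [\/ f = Omega i, f = yv i | f = xv i].

Definition admissible (T : A -> Prop) : Prop :=
  [/\ forall f, T f -> calP f,
      forall i j : 'I_n, i = j.+1 :> nat ->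
        (T (yv i) \/ T (xv i)) <-> (T (Omega i) /\ T (Omega j))
    & forall i : 'I_n, i = 0%N :> nat ->
        (T (yv i) \/ T (xv i)) <-> T (Omega i)].

Definition in_K (h : 'rV[k]_(n + n)) : Prop :=
  forall i j : 'I_n,
    h 0 (lshift n i) + h 0 (rshift n i) = h 0 (lshift n j) + h 0 (rshift n j).

Definition K_act (h : 'rV[k]_(n + n)) (f : A) : A :=
  \sum_(i < n) (h 0 (lshift n i) *: (yv i * f^`M(lshift n i))
                + h 0 (rshift n i) *: (xv i * f^`M(rshift n i))).

Definition K_stable (I : A -> Prop) : Prop :=
  forall h, in_K h -> forall f, I f -> I (K_act h f).

Definition K_prime_poisson_ideal (I : A -> Prop) : Prop :=
  [/\ poisson_ideal bracket I, ~ I 1, K_stable I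
    & forall I1 I2 : A -> Prop,
        poisson_ideal bracket I1 -> K_stable I1 ->
        poisson_ideal bracket I2 -> K_stable I2 ->
        (forall f, ideal_prod I1 I2 f -> I f) ->
        (forall f, I1 f -> I f) \/ (forall f, I2 f -> I f)].

Lemma bracketDl f g h : bracket (f + g) h = bracket f h + bracket g h.
Proof.
rewrite /bracket -big_split; apply: eq_bigr => a _ /=.
by rewrite -big_split; apply: eq_bigr => b _ /=; rewrite mderivD; ring.
Qed.

Lemma bracketZl (c : k) f h : bracket (c *: f) h = c *: bracket f h.
Proof.
rewrite /bracket scaler_sumr; apply: eq_bigr => a _.
rewrite scaler_sumr; apply: eq_bigr => b _.
by rewrite mderivZ -!scalerAl.
Qed.

Lemma bracket_leibniz f g h :
  bracket (f * g) h = f * bracket g h + g * bracket f h.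
Proof.
rewrite /bracket !mulr_sumr -big_split; apply: eq_bigr => a _ /=.
rewrite !mulr_sumr -big_split; apply: eq_bigr => b _ /=.
by rewrite mderivM; ring.
Qed.

Lemma mderiv_var (a b : 'I_(n + n)) : ('X_a : A)^`M(b) = (a == b)%:R.
Proof.
rewrite mderivX mnm1E; case: eqVneq => [->|_]; last by rewrite scale0r.
rewrite scale1r -[RHS]mpolyX0; congr mpolyX.
by apply/mnmP=> c; rewrite mnmBE subnn mnm0E.
Qed.

Lemma bracket_gen (a b : 'I_(n + n)) : bracket 'X_a 'X_b = bracket_var a b.
Proof.
rewrite /bracket (bigD1 a) //= (bigD1 b) //= !mderiv_var !eqxx !mul1r.
rewrite !big1 ?addr0 // => [c ca|c cb].
  by rewrite big1 // => d _; rewrite mderiv_var eq_sym (negPf ca) !mul0r.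
by rewrite mderiv_var eq_sym (negPf cb) mulr0 mul0r.
Qed.

Lemma bracket_yy i j : bracket (yv i) (yv j) = Gamma i j *: (yv i * yv j).
Proof. by rewrite bracket_gen /bracket_var -!/(unsplit (inl _)) !unsplitK. Qed.

Lemma bracket_xyE i j : bracket (xv i) (yv j) = bracket_xy i j.
Proof.
by rewrite bracket_gen /bracket_var -/(unsplit (inl _))
  -/(unsplit (inr _)) !unsplitK.
Qed.

Lemma bracket_yxE i j : bracket (yv i) (xv j) = - bracket_xy j i.
Proof.
by rewrite bracket_gen /bracket_var -/(unsplit (inl _))
  -/(unsplit (inr _)) !unsplitK.
Qed.

Lemma bracket_xxE i j : bracket (xv i) (xv j) = bracket_xx i j.
Proof. by rewrite bracket_gen /bracket_var -!/(unsplit (inr _)) !unsplitK. Qed.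

Lemma bracket_xy_lt (i j : 'I_n) : (i < j)%N ->
  bracket (xv i) (yv j) = (P 0 j - Gamma i j) *: (yv j * xv i).
Proof. by move=> ij; rewrite bracket_xyE /bracket_xy ij. Qed.

Lemma bracket_yx_lt (i j : 'I_n) : (i < j)%N ->
  bracket (yv i) (xv j) = - (Q 0 i + Gamma i j) *: (yv i * xv j).
Proof.
by move=> ij; rewrite bracket_yxE /bracket_xy ltnNge ltnW // ij scaleNr.
Qed.

Lemma bracket_xx_lt (i j : 'I_n) : (i < j)%N ->
  bracket (xv i) (xv j) = (Q 0 i - P 0 j + Gamma i j) *: (xv i * xv j).
Proof. by move=> ij; rewrite bracket_xxE /bracket_xx ij. Qed.

Lemma bracket_xy_eq (i : 'I_n) :
  bracket (xv i) (yv i) = Q 0 i *: (yv i * xv i)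
    + \sum_(l < n | (l < i)%N) (Q 0 l - P 0 l) *: (yv l * xv l).
Proof. by rewrite bracket_xyE /bracket_xy ltnn. Qed.

Hypothesis char0 : [pchar k] =i pred0.
Hypothesis skew : Gamma^T = - Gamma.

Lemma skewE i j : Gamma j i = - Gamma i j.
Proof. by have := congr1 (fun M : 'M_n => M i j) skew; rewrite !mxE. Qed.

Lemma skew_diag i : Gamma i i = 0.
Proof.
have /eqP := skewE i i; rewrite -subr_eq0 opprK -mulr2n -mulr_natr mulf_eq0.
by rewrite ((pcharf0P k).1 char0) orbF => /eqP.
Qed.

Lemma bracket_varC a b : bracket_var a b = - bracket_var b a.
Proof.
rewrite /bracket_var; case: (split a) => i; case: (split b) => j.
- by rewrite (skewE j i) scaleNr mulrC.
- by [].
- by rewrite opprK.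
- by rewrite /bracket_xx; case: (ltngtP i j) => ij; rewrite ?opprK ?oppr0.
Qed.


Lemma bracketC f g : bracket f g = - bracket g f.
Proof.
rewrite /bracket exchange_big /= -sumrN; apply: eq_bigr => a _.
rewrite -sumrN; apply: eq_bigr => b _.
by rewrite (bracket_varC b a) mulrN (mulrC (mderiv b f)).
Qed.

Lemma bracketDr f g h : bracket h (f + g) = bracket h f + bracket h g.
Proof. by rewrite bracketC bracketDl opprD -!(bracketC h). Qed.

Lemma bracketZr (c : k) f h : bracket h (c *: f) = c *: bracket h f.
Proof. by rewrite bracketC bracketZl -scalerN -(bracketC h). Qed.

Lemma bracketNl f h : bracket (- f) h = - bracket f h.
Proof. by rewrite -scaleN1r bracketZl scaleN1r. Qed.

Lemma bracketNr f h : bracket h (- f) = - bracket h f.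
Proof. by rewrite -scaleN1r bracketZr scaleN1r. Qed.

Lemma bracket_leibnizr f g h :
  bracket h (f * g) = f * bracket h g + g * bracket h f.
Proof.
by rewrite bracketC bracket_leibniz opprD -!mulrN -!(bracketC h).
Qed.

Lemma bracketff f : bracket f f = 0.
Proof.
have /eqP := bracketC f f; rewrite -subr_eq0 opprK -mulr2n -scaler_nat.
by rewrite scaler_eq0 ((pcharf0P k).1 char0) => /eqP.
Qed.

Lemma derivation_eq0 (D : A -> A) :
  (forall f g, D (f + g) = D f + D g) ->
  (forall (c : k) f, D (c *: f) = c *: D f) ->
  (forall f g, D (f * g) = f * D g + g * D f) ->
  (forall a, D 'X_a = 0) -> forall f, D f = 0.
Proof.
move=> DD DZ DM DX.
have D0 : D 0 = 0 by have := DZ 0 0; rewrite !scale0r.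
have D1 : D 1 = 0.
  have /(congr1 (fun z => z - D 1)) := DM 1 1.
  by rewrite !mul1r subrr addrK.
elim/mpolyind => [|c m p _ _ IH]; first exact: D0.
rewrite DD DZ IH addr0 mpolyXE_id.
elim/big_ind: _ => [|f g Df Dg|a _]; first by rewrite D1 scaler0.
  move: Df Dg; have [->|c0] := eqVneq c 0; first by rewrite !scale0r.
  move=> /eqP; rewrite scaler_eq0 (negPf c0) => /eqP Df.
  move=> /eqP; rewrite scaler_eq0 (negPf c0) => /eqP Dg.
  by rewrite DM Df Dg !mulr0 addr0 scaler0.
elim: (m a) => [|d IHd]; first by rewrite D1 scaler0.
by rewrite exprS DM DX mulr0 addr0 scalerAr IHd mulr0.
Qed.

Let jac f g h :=
  bracket f (bracket g h) + bracket g (bracket h f) + bracket h (bracket f g).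

Let jacC f g h : jac f g h = jac g h f.
Proof. by rewrite /jac; move: bracket => br; rewrite [RHS]addrC addrA. Qed.

Let jac_der f f' g h : jac (f * f') g h = f * jac f' g h + f' * jac f g h.
Proof.
rewrite /jac bracket_leibniz (bracket_leibnizr f f' h) (bracket_leibniz f f' g).
rewrite !bracketDr !bracket_leibnizr.
rewrite (bracketC f g) (bracketC f' g) !bracketNr.
by move: bracket => br; ring.
Qed.

Let jac_eq0 g h : (forall a, jac 'X_a g h = 0) -> forall f, jac f g h = 0.
Proof.
move=> H; apply: derivation_eq0 => //.
- move=> f f'; rewrite /jac bracketDl !(bracketDr, bracketDl).
  by move: bracket => br; ring.
- move=> c f; rewrite /jac 2!(bracketZl c f) (bracketZr c f) !scalerDr.
  by rewrite (bracketZr c (bracket h f)) (bracketZr c (bracket f g)).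
Qed.

(* The bracket of two variables is log-canonical, with coefficients lamxy,
   lamxx and Gamma, except that {x_i, y_i} has the extra term W i. *)
Let lamxy (i j : 'I_n) : k :=
  if (i < j)%N then P 0 j - Gamma i j
  else if (j < i)%N then Q 0 j + Gamma j i else Q 0 i.

Let lamxx (i j : 'I_n) : k :=
  if (i < j)%N then Q 0 i - P 0 j + Gamma i j
  else if (j < i)%N then - (Q 0 j - P 0 i + Gamma j i) else 0.

Let W (m : nat) : A :=
  \sum_(l < n | (l < m)%N) (Q 0 l - P 0 l) *: (yv l * xv l).

Let WS (i : 'I_n) : W i.+1 = W i + (Q 0 i - P 0 i) *: (yv i * xv i).
Proof.
rewrite /W (bigD1 i) //= addrC; congr (_ + _); apply: eq_bigl => l.
by rewrite ltnS ltn_neqAle andbC.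
Qed.

Let brxyE i j : bracket (xv i) (yv j) =
  (lamxy i j)%:MP * (yv j * xv i) + (i == j)%:R * W i.
Proof.
rewrite bracket_xyE /bracket_xy /lamxy mul_mpolyC -val_eqE /=.
by case: ltngtP => // ij; rewrite ?mul0r ?addr0 // mul1r (ord_inj ij).
Qed.

Let bryxE i j : bracket (yv i) (xv j) =
  - ((lamxy j i)%:MP * (yv i * xv j) + (j == i)%:R * W j).
Proof. by rewrite bracketC brxyE. Qed.

Let brxxE i j : bracket (xv i) (xv j) = (lamxx i j)%:MP * (xv i * xv j).
Proof.
rewrite bracket_xxE /bracket_xx /lamxx mul_mpolyC.
by case: ltngtP => ij //; rewrite ?scale0r // scaleNr mulrC.
Qed.

Let bryyE i j : bracket (yv i) (yv j) = (Gamma i j)%:MP * (yv i * yv j).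
Proof. by rewrite bracket_yy mul_mpolyC. Qed.

Let W0 : W 0 = 0. Proof. by rewrite /W big1. Qed.

Let br_y_W (j : 'I_n) (m : nat) : (m <= n)%N -> bracket (yv j) (W m) =
  - (if (j < m)%N then Q 0 j else P 0 j)%:MP * (yv j * W m).
Proof.
elim: m => [|m IH] lt_mn.
  by rewrite W0 !mulr0 -[in LHS](scale0r 0) bracketZr scale0r.
rewrite -[m]/(val (Ordinal lt_mn)); set l := Ordinal lt_mn.
rewrite WS bracketDr (IH (ltnW lt_mn)) bracketZr bracket_leibnizr bryxE bryyE.
rewrite -!mul_mpolyC ltnS -val_eqE -[m]/(val l) /= /lamxy.
case: ltngtP => lj; rewrite ?mul0r ?addr0 ?mul1r.
- rewrite (skewE l j) /=; ring.
- rewrite (skewE l j) /=; ring.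
- have -> : j = l by exact: val_inj.
  by rewrite skew_diag; ring.
Qed.

Let br_x_W (j : 'I_n) (m : nat) : (m <= n)%N -> bracket (xv j) (W m) =
  (if (j < m)%N then Q 0 j else P 0 j)%:MP * (xv j * W m).
Proof.
elim: m => [|m IH] lt_mn.
  by rewrite W0 !mulr0 -[in LHS](scale0r 0) bracketZr scale0r.
rewrite -[m]/(val (Ordinal lt_mn)); set l := Ordinal lt_mn.
rewrite WS bracketDr (IH (ltnW lt_mn)) bracketZr bracket_leibnizr brxyE brxxE.
rewrite -!mul_mpolyC ltnS -val_eqE -[m]/(val l) /= /lamxy /lamxx.
case: ltngtP => lj; rewrite ?mul0r ?addr0 ?mul1r.
- ring.
- ring.
- have -> : j = l by exact: val_inj.
  by ring.
Qed.

Let jac_alt f g : jac f f g = 0.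
Proof.
by rewrite /jac bracketff (bracketC g f) bracketNr subrr add0r
  -[in LHS](scale0r 0) bracketZr scale0r.
Qed.

Let jac_anti f g h : jac f g h = - jac g f h.
Proof.
rewrite /jac (bracketC h g) (bracketC f h) (bracketC g f) !bracketNr.
by move: bracket => br; ring.
Qed.

Let jac_extra (a b c w : A) (u v t : k) :
  bracket a b = u%:MP * (a * b) + w -> bracket b c = v%:MP * (b * c) ->
  bracket c a = t%:MP * (c * a) -> bracket c w = (t - v)%:MP * (c * w) ->
  jac a b c = 0.
Proof.
move=> ab bc ca cw; rewrite /jac ab bc ca bracketDr cw !mul_mpolyC !bracketZr.
rewrite !bracket_leibnizr (bracketC a c) (bracketC b a) (bracketC c b).
by rewrite ab bc ca -!mul_mpolyC; move: bracket => br; ring.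
Qed.

Let jac_log (a b c : A) (u v t : k) :
  bracket a b = u%:MP * (a * b) -> bracket b c = v%:MP * (b * c) ->
  bracket c a = t%:MP * (c * a) -> jac a b c = 0.
Proof.
move=> ab bc ca; apply: (@jac_extra _ _ _ 0 u v t); rewrite ?addr0 //.
by rewrite mulr0 mulr0 -[in LHS](scale0r 0) bracketZr scale0r.
Qed.

Let brxyN i j : i != j -> bracket (xv i) (yv j) = (lamxy i j)%:MP * (xv i * yv j).
Proof. by move=> /negPf ij; rewrite brxyE ij mul0r addr0 (mulrC (yv j)). Qed.

Let bryxN i j : j != i ->
  bracket (yv i) (xv j) = (- lamxy j i)%:MP * (yv i * xv j).
Proof. by move=> /negPf ij; rewrite bryxE ij mul0r addr0 mpolyCN mulNr. Qed.

Let brxyD i : bracket (xv i) (yv i) = (Q 0 i)%:MP * (xv i * yv i) + W i.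
Proof. by rewrite brxyE /lamxy ltnn eqxx mul1r (mulrC (yv i)). Qed.

Let jac_xyy i j : i != j -> jac (xv i) (yv i) (yv j) = 0.
Proof.
move=> ij; apply: (jac_extra (brxyD i) (bryyE i j) (bryxN ij)).
rewrite br_y_W ?(ltnW (ltn_ord i)) // -mpolyCN; congr (_%:MP * _).
rewrite /lamxy; move: ij; rewrite -val_eqE /=.
by case: ltngtP => // _ _; rewrite ?(skewE i j); ring.
Qed.

Let jac_xyx i l : i != l -> jac (xv i) (yv i) (xv l) = 0.
Proof.
move=> il; have li : l != i by rewrite eq_sym.
apply: (jac_extra (brxyD i) (bryxN li) (brxxE l i)).
rewrite br_x_W ?(ltnW (ltn_ord i)) //; congr (_%:MP * _).
rewrite /lamxy /lamxx; move: il; rewrite -val_eqE /=.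
by case: ltngtP => // _ _; ring.
Qed.

Let jac_yyx i j l : jac (yv i) (yv j) (xv l) = 0.
Proof.
have [->|ij] := eqVneq i j; first exact: jac_alt.
have [->|li] := eqVneq l i; first by rewrite -jacC jac_xyy.
have [->|lj] := eqVneq l j; last exact: (jac_log (bryyE _ _) (bryxN lj) (brxyN li)).
by rewrite jac_anti -jacC jac_xyy ?oppr0 // eq_sym.
Qed.

Let jac_xxy i j l : jac (xv i) (xv j) (yv l) = 0.
Proof.
have [->|ij] := eqVneq i j; first exact: jac_alt.
have [<-|il] := eqVneq i l; first by rewrite jac_anti jacC jac_xyx ?oppr0.
have [<-|jl] := eqVneq j l; first by rewrite jacC jac_xyx // eq_sym.
by apply: (jac_log (brxxE _ _) (brxyN jl) (bryxN il)).
Qed.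

Let jac_gen a b c : jac 'X_a 'X_b 'X_c = 0.
Proof.
rewrite -(splitK a) -(splitK b) -(splitK c).
case: (split a) => i; case: (split b) => j; case: (split c) => l /=.
- exact: (jac_log (bryyE _ _) (bryyE _ _) (bryyE _ _)).
- exact: jac_yyx.
- by rewrite -jacC; exact: jac_yyx.
- by rewrite jacC; exact: jac_xxy.
- by rewrite jacC; exact: jac_yyx.
- by rewrite -jacC; exact: jac_xxy.
- exact: jac_xxy.
- exact: (jac_log (brxxE _ _) (brxxE _ _) (brxxE _ _)).
Qed.

Lemma bracket_jacobi f g h :
  bracket f (bracket g h) + bracket g (bracket h f) + bracket h (bracket f g)
  = 0.
Proof.
rewrite -/(jac f g h); apply: jac_eq0 => a; rewrite jacC.
apply: jac_eq0 => b; rewrite jacC; apply: jac_eq0 => c; exact: jac_gen.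
Qed.

Lemma bracket_poisson : is_poisson_bracket bracket.
Proof.
split.
- by move=> c f g h; rewrite bracketDl bracketZl.
- by move=> c f g h; rewrite bracketDr bracketZr.
- exact: bracketff.
- exact: bracket_jacobi.
- exact: bracket_leibniz.
Qed.

Lemma bracket_unique br :
  is_poisson_bracket br ->
  (forall i j, br (yv i) (yv j) = Gamma i j *: (yv i * yv j)) ->
  (forall i j : 'I_n, (i < j)%N ->
    br (xv i) (yv j) = (P 0 j - Gamma i j) *: (yv j * xv i)) ->
  (forall i j : 'I_n, (i < j)%N ->
    br (yv i) (xv j) = - (Q 0 i + Gamma i j) *: (yv i * xv j)) ->
  (forall i j : 'I_n, (i < j)%N ->
    br (xv i) (xv j) = (Q 0 i - P 0 j + Gamma i j) *: (xv i * xv j)) ->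
  (forall i : 'I_n, br (xv i) (yv i) = Q 0 i *: (yv i * xv i)
    + \sum_(l < n | (l < i)%N) (Q 0 l - P 0 l) *: (yv l * xv l)) ->
  forall f g, br f g = bracket f g.
Proof.
case=> brl brr br0 _ brM byy bxy byx bxx bd.
have brDl f g h : br (f + g) h = br f h + br g h.
  by have := brl 1 f g h; rewrite !scale1r.
have brDr f g h : br h (f + g) = br h f + br h g.
  by have := brr 1 f g h; rewrite !scale1r.
have brC f g : br f g = - br g f.
  have := br0 (f + g); rewrite brDl !brDr !br0 add0r addr0 => /eqP.
  by rewrite addr_eq0 => /eqP.
have br0l h : br 0 h = 0.
  have /(congr1 (fun z => z - br 0 h)) := brDl 0 0 h.
  by rewrite addr0 subrr addrK => <-.
have brZl c f h : br (c *: f) h = c *: br f h.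
  by have := brl c f 0 h; rewrite br0l !addr0.
have gen (a b : 'I_(n + n)) : br 'X_a 'X_b = bracket 'X_a 'X_b.
  rewrite -(splitK a) -(splitK b).
  have xy i j : br (xv i) (yv j) = bracket (xv i) (yv j).
    have [ij|ji|/ord_inj <-] := ltngtP i j; last by rewrite bd bracket_xy_eq.
      by rewrite bxy // bracket_xy_lt.
    by rewrite brC byx // bracketC bracket_yx_lt.
  case: (split a) => i; case: (split b) => j /=.
  - by rewrite byy bracket_yy.
  - by rewrite brC xy -bracketC.
  - exact: xy.
  - have [ij|ji|/ord_inj <-] := ltngtP i j; last by rewrite br0 bracketff.
      by rewrite bxx // bracket_xx_lt.
    by rewrite brC bxx // bracketC bracket_xx_lt.
have ext h : (forall a, br 'X_a h = bracket 'X_a h) ->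
    forall f, br f h = bracket f h.
  move=> H f; apply/eqP; rewrite -subr_eq0; apply/eqP; move: f.
  apply: derivation_eq0 => [f g|c f|f g|a].
  - by rewrite brDl bracketDl opprD addrACA.
  - by rewrite brZl bracketZl scalerBr.
  - rewrite brM bracket_leibniz; move: bracket => b; ring.
  - by rewrite H subrr.
move=> f g; apply: (ext) => a.
rewrite brC bracketC; congr (- _); apply: ext => b; exact: gen.
Qed.

End PoissonAlgebra.

(* Main.v *)
(* Let I be K-prime and T the set of elements of calP lying in I. Since
   y_i x_i is proportional to Omega_i - Omega_(i-1), the algebra is spanned by
   the products M * Omega^e, where the monomial M contains no y_i x_i. The group
   K and the bracket with a variable z = y_j or x_j whose partner does not
   divide M act on these products by eigenvalues (up to the factor z for the
   bracket), and the eigenvalues tell any two of them apart: K determines M and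
   the degree of e, and the bracket with z then determines the sum of the e_i
   over i >= j. Hence a combination of products that avoid T can lie in I only
   if a single such product does. The latter is impossible: an element that is
   normal modulo I and not in I is regular modulo I, and a factor z of M that is
   not normal modulo I can be traded by a bracket for a regular Omega_(j-1). *)
Require Import Defs.
From mathcomp Require Import all_boot all_order all_algebra.
From mathcomp Require Import mpoly.
From mathcomp Require Import ring zify.
From Stdlib Require Import Classical_Prop.

Set Implicit Arguments.
Unset Strict Implicit.
Unset Printing Implicit Defensive.

Import GRing.Theory.
Local Open Scope ring_scope.

(** * Ideals and ideals generated by a set *)

Section Ideals.
Variable A : comNzRingType.
Implicit Types (I T : A -> Prop).

Lemma ideal_sum I (J : eqType) (r : seq J) (F : J -> A) :
  is_ideal I -> (forall i, i \in r -> I (F i)) -> I (\sum_(i <- r) F i).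
Proof.
move=> idI H; rewrite big_seq; elim/big_ind: _ => //; first exact: ideal0.
exact: idealD.
Qed.

Lemma idealN I f : is_ideal I -> I f -> I (- f).
Proof. by move=> idI If; rewrite -mulN1r; apply: idealM. Qed.

Lemma idealB I f g : is_ideal I -> I f -> I g -> I (f - g).
Proof. by move=> idI If Ig; apply: idealD => //; apply: idealN. Qed.

Lemma idealDr I f g : is_ideal I -> I f -> I (f + g) -> I g.
Proof. by move=> idI If Ifg; rewrite -[g](addKr f) addrC; apply: idealB. Qed.

Lemma ideal_gen_ideal T : is_ideal (ideal_gen T).
Proof.
split; first by exists [::]; rewrite big_nil.
  move=> f g [s [Hs ->]] [t [Ht ->]]; exists (s ++ t); rewrite big_cat.
  by split=> // u; rewrite mem_cat => /orP[/Hs|/Ht].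
move=> f g [s [Hs ->]]; exists [seq (f * u.1, u.2) | u <- s]; split.
  by move=> _ /mapP[u /Hs Tu ->].
by rewrite big_map mulr_sumr; apply: eq_bigr => u _; rewrite mulrA.
Qed.

Lemma mem_ideal_gen T f : T f -> ideal_gen T f.
Proof.
move=> Tf; exists [:: (1, f)]; rewrite big_seq1 mul1r; split=> // u.
by rewrite inE => /eqP->.
Qed.

Lemma ideal_gen_sub I T :
  is_ideal I -> (forall f, T f -> I f) -> forall f, ideal_gen T f -> I f.
Proof.
move=> idI TI f [s [Hs ->]]; apply: ideal_sum => // u /Hs Tu.
by apply: idealM => //; apply: TI.
Qed.

End Ideals.

Lemma idealZ (k : fieldType) (A : comAlgType k) (I : A -> Prop) c f :
  is_ideal I -> I f -> I (c *: f).
Proof. by move=> idI If; rewrite -mulr_algl; apply: idealM. Qed.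

Lemma idealZV (k : fieldType) (A : comAlgType k) (I : A -> Prop) c f :
  is_ideal I -> c != 0 -> I (c *: f) -> I f.
Proof. by move=> idI c0 /(idealZ c^-1 idI); rewrite scalerA mulVf // scale1r. Qed.

(** * Derivations and their eigenvectors up to a fixed factor *)

Section Derivations.
Variables (k : fieldType) (A : comAlgType k).

Record is_derivation (D : A -> A) : Prop := IsDerivation {
  derD : forall f g, D (f + g) = D f + D g;
  derZ : forall c f, D (c *: f) = c *: D f;
  derM : forall f g, D (f * g) = f * D g + g * D f }.

Variables (D : A -> A) (derD_ : is_derivation D) (z : A).

Lemma der0 : D 0 = 0.
Proof. by have := derZ derD_ 0 0; rewrite !scale0r. Qed.

Lemma der1 : D 1 = 0.
Proof.
have := derM derD_ 1 1; rewrite !mul1r => /(congr1 (fun z => z - D 1)).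
by rewrite subrr addrK.
Qed.

Lemma der_sum (J : Type) (r : seq J) (S : pred J) (F : J -> A) :
  D (\sum_(i <- r | S i) F i) = \sum_(i <- r | S i) D (F i).
Proof. by apply: big_morph; [apply: derD | apply: der0]. Qed.

(** The factor [z] lets one computation serve both the action of [K], where [z] is 1, and the
    bracket with a variable, where [z] is that variable. *)
Lemma der_eigenM a b f g : D f = a *: (z * f) -> D g = b *: (z * g) ->
  D (f * g) = (a + b) *: (z * (f * g)).
Proof.
move=> Df Dg; rewrite derM // Df Dg -!scalerAr scalerDl addrC.
by rewrite (mulrCA f) (mulrCA g) (mulrC g).
Qed.

Lemma der_eigenX a f e : D f = a *: (z * f) ->
  D (f ^+ e) = (e%:R * a) *: (z * f ^+ e).
Proof.
move=> Df; elim: e => [|e IH]; first by rewrite der1 mul0r scale0r.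
by rewrite exprS (der_eigenM Df IH) -natr1 mulrDl mul1r addrC.
Qed.

(** Asking for eigenvectors only where the exponent is positive matters: the bracket with a variable
    is not of this form on its partner, which must then be absent. *)
Lemma der_eigen_prod (J : finType) (v : J -> A) (e : J -> nat) (a : J -> k) :
  (forall i, (0 < e i)%N -> D (v i) = a i *: (z * v i)) ->
  D (\prod_i v i ^+ e i) =
    (\sum_i (e i)%:R * a i) *: (z * \prod_i v i ^+ e i).
Proof.
move=> Dv; apply: (big_ind2 (fun f c => D f = c *: (z * f))).
- by rewrite der1 scale0r.
- by move=> f c g d; apply: der_eigenM.
- move=> i _; case: (posnP (e i)) => [->|/Dv]; last exact: der_eigenX.
  by rewrite der1 mul0r scale0r.
Qed.

End Derivations.

(** * Natural numbers in characteristic zero *)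

Lemma natr_char0_eq0 (k : fieldType) (c : nat) :
  [pchar k] =i pred0 -> ((c%:R : k) == 0) = (c == 0%N).
Proof. by move=> /pcharf0P ->. Qed.

Lemma natr_char0_inj (k : fieldType) : [pchar k] =i pred0 ->
  injective (fun c => c%:R : k).
Proof.
move=> char0 c d; wlog le_cd : c d / (c <= d)%N => [H|] /=.
  by case/orP: (leq_total c d) => /H h // /esym /h.
move/esym/eqP; rewrite -subr_eq0 -natrB // natr_char0_eq0 // subn_eq0 => le_dc.
by apply/eqP; rewrite eqn_leq le_cd.
Qed.

(** * Uniform indexing of the variables, and their brackets *)

Section Poisson.
Variables (k : fieldType) (n : nat) (Gamma : 'M[k]_n) (P Q : 'rV[k]_n).
Hypotheses (char0 : [pchar k] =i pred0) (skew : Gamma^T = - Gamma).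
Hypothesis neqPQ : forall i, P 0 i <> Q 0 i.
Local Notation A := {mpoly k[n + n]}.
Local Notation br := (bracket Gamma P Q).

Definition idx (a : 'I_(n + n)) : 'I_n :=
  match split a with inl i => i | inr i => i end.

Definition partner (a : 'I_(n + n)) : 'I_(n + n) :=
  match split a with inl i => rshift n i | inr i => lshift n i end.

Definition sgn (a : 'I_(n + n)) : k :=
  match split a with inl _ => -1 | inr _ => 1 end.

Lemma split_l i : split (lshift n i : 'I_(n + n)) = inl i.
Proof. exact: (unsplitK (inl i)). Qed.

Lemma split_r i : split (rshift n i : 'I_(n + n)) = inr i.
Proof. exact: (unsplitK (inr i)). Qed.

Lemma var_ind (S : 'I_(n + n) -> Prop) :
  (forall i, S (lshift n i)) -> (forall i, S (rshift n i)) -> forall a, S a.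
Proof. by move=> Sl Sr a; rewrite -(splitK a); case: (split a). Qed.

Lemma partnerK a : partner (partner a) = a.
Proof. by elim/var_ind: a => i; rewrite /partner !(split_l, split_r). Qed.

Lemma partner_neq a : partner a != a.
Proof.
elim/var_ind: a => i; rewrite /partner ?split_l ?split_r.
  by rewrite eq_rlshift.
by rewrite eq_lrshift.
Qed.

Lemma idx_partner a : idx (partner a) = idx a.
Proof. by elim/var_ind: a => i; rewrite /idx /partner !(split_l, split_r). Qed.

Lemma sgn_neq0 a : sgn a != 0.
Proof. by rewrite /sgn; case: (split a) => _; rewrite ?oppr_eq0 oner_eq0. Qed.

(* [W i.+1 = Omega i]; [W 0 = 0] is the empty sum below the first [Omega]. *)
Definition W (m : nat) : A :=
  \sum_(l < n | (l < m)%N) (Q 0 l - P 0 l) *: (yv k l * xv k l).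

Lemma OmegaE i : Omega P Q i = W i.+1.
Proof. by []. Qed.

Lemma W0 : W 0 = 0. Proof. by rewrite /W big1. Qed.

Lemma WS (i : 'I_n) : W i.+1 = W i + (Q 0 i - P 0 i) *: (yv k i * xv k i).
Proof.
rewrite /W (bigD1 i) //= addrC; congr (_ + _); apply: eq_bigl => l.
by rewrite ltnS ltn_neqAle andbC.
Qed.

Lemma W_pred (i : 'I_n) :
  (i = 0%N :> nat /\ W i = 0) \/
  exists j : 'I_n, i = j.+1 :> nat /\ W i = Omega P Q j.
Proof.
case: i => -[|m] lt_m /=; first by left; rewrite W0.
by right; exists (Ordinal (ltnW lt_m)).
Qed.

(** Coefficients of the log-canonical part of the bracket; only partners have a further term. *)
Definition log_coef (a b : 'I_(n + n)) : k :=
  let xy (i j : 'I_n) := if (i < j)%N then P 0 j - Gamma i j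
    else if (j < i)%N then Q 0 j + Gamma j i else Q 0 i in
  match split a, split b with
  | inl i, inl j => Gamma i j
  | inr i, inl j => xy i j
  | inl i, inr j => - xy j i
  | inr i, inr j => if (i < j)%N then Q 0 i - P 0 j + Gamma i j
    else if (j < i)%N then - (Q 0 j - P 0 i + Gamma j i) else 0
  end.

Lemma bracket_var_log a b : br 'X_a 'X_b =
  log_coef a b *: ('X_a * 'X_b) + (b == partner a)%:R * (sgn a *: W (idx a)).
Proof.
rewrite bracket_gen /bracket_var /log_coef /partner /sgn /idx.
elim/var_ind: a => i; elim/var_ind: b => j; rewrite !(split_l, split_r).
- by rewrite eq_lrshift mul0r addr0.
- rewrite (inj_eq (@rshift_inj _ _)) /bracket_xy eq_sym -val_eqE /=.
  case: ltngtP => [ij|ij|/ord_inj ->];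
    rewrite ?mul0r ?addr0 ?mul1r ?scaleNr ?scale1r //.
  by rewrite opprD.
- rewrite (inj_eq (@lshift_inj _ _)) /bracket_xy eq_sym -val_eqE /=.
  case: ltngtP => [ij|ij|/ord_inj ->];
    by rewrite ?mul0r ?addr0 ?mul1r ?scale1r // mulrC.
- rewrite eq_rlshift mul0r addr0 /bracket_xx.
  by case: ltngtP => ij //; rewrite ?scale0r // scaleNr mulrC.
Qed.

Lemma bracket_derivation f : is_derivation (br f).
Proof.
split=> [g h|c g|g h]; first exact: bracketDr.
  exact: bracketZr.
exact: bracket_leibnizr.
Qed.

(** Up to [sgn a], each [y_l x_l] with [l] below [idx a] has coefficient [P], and each one above has
    [Q]. At [l = idx a] the extra term of the bracket, weighted by [Q - P], changes the coefficient
    of [W l] from [P] to [Q], so the partial sums stay eigenvectors. *)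
Lemma bracket_W a (m : nat) : (m <= n)%N -> br 'X_a (W m) =
  (sgn a * (if (idx a < m)%N then Q 0 (idx a) else P 0 (idx a)))
    *: ('X_a * W m).
Proof.
have D := bracket_derivation 'X_a.
elim: m => [|m IH] lt_mn; first by rewrite W0 mulr0 scaler0 der0.
rewrite -[m]/(val (Ordinal lt_mn)); set l := Ordinal lt_mn.
rewrite WS (derD D) (IH (ltnW lt_mn)) (derZ D) (derM D) !bracket_var_log.
rewrite /log_coef /partner /sgn /idx ltnS.
elim/var_ind: a D IH => j _ _; rewrite !(split_l, split_r) /=.
  rewrite eq_lrshift (inj_eq (@rshift_inj _ _)) -val_eqE -[m]/(val l) /=.
  rewrite -!mul_mpolyC !rmorphM /= !rmorphN /= rmorph1.
  case: (ltngtP l j) => lj; rewrite ?mul0r ?addr0 ?mul1r.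
  - by rewrite (skewE skew l j) /xv /yv; ring.
  - by rewrite (skewE skew l j) /xv /yv; ring.
  - have -> : j = l by exact: val_inj.
    by rewrite (skew_diag char0 skew) /xv /yv; ring.
rewrite eq_rlshift (inj_eq (@lshift_inj _ _)) -val_eqE -[m]/(val l) /=.
rewrite -!mul_mpolyC !rmorphM /= rmorph1.
case: (ltngtP l j) => lj; rewrite ?mul0r ?addr0 ?mul1r.
- by rewrite /xv /yv; ring.
- by rewrite /xv /yv; ring.
- have -> : j = l by exact: val_inj.
  by rewrite /xv /yv; ring.
Qed.

Lemma bracket_sumr f g : br f g = \sum_b g^`M(b) * br f 'X_b.
Proof.
rewrite /bracket exchange_big; apply: eq_bigr => b _ /=.
rewrite mulr_sumr; apply: eq_bigr => a _.
rewrite (bigD1 b) //= big1 => [|c cb]; rewrite ?mderiv_var ?eqxx; last first.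
  by rewrite eq_sym (negPf cb) mulr0 mul0r.
by rewrite addr0 mulr1; ring.
Qed.

(** * The action of [K] *)

Lemma K_act_derivation (h : 'rV[k]_(n + n)) : is_derivation (K_act h).
Proof.
split=> [f g|c f|f g]; rewrite /K_act.
- rewrite -big_split; apply: eq_bigr => i _ /=.
  by rewrite !mderivD -!mul_mpolyC; ring.
- rewrite scaler_sumr; apply: eq_bigr => i _ /=.
  by rewrite !mderivZ -!mul_mpolyC; ring.
- rewrite !mulr_sumr -big_split; apply: eq_bigr => i _ /=.
  by rewrite !mderivM -!mul_mpolyC; ring.
Qed.

Lemma K_act_var (h : 'rV[k]_(n + n)) a : K_act h 'X_a = h 0 a *: 'X_a.
Proof.
rewrite /K_act; elim/var_ind: a => i; rewrite (bigD1 i) //= big1 => [|j ji].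
- by rewrite addr0 !mderiv_var eqxx eq_lrshift mulr0 scaler0 addr0 mulr1.
- rewrite !mderiv_var eq_lrshift (inj_eq (@lshift_inj _ _)) eq_sym (negPf ji).
  by rewrite !mulr0 !scaler0 addr0.
- by rewrite addr0 !mderiv_var eqxx eq_rlshift mulr0 scaler0 add0r mulr1.
- rewrite !mderiv_var eq_rlshift (inj_eq (@rshift_inj _ _)) eq_sym (negPf ji).
  by rewrite !mulr0 !scaler0 addr0.
Qed.

Lemma K_act_W (h : 'rV[k]_(n + n)) c m :
  (forall i, h 0 (lshift n i) + h 0 (rshift n i) = c) ->
  K_act h (W m) = c *: W m.
Proof.
move=> hc; have D := K_act_derivation h.
rewrite /W (der_sum D) scaler_sumr; apply: eq_bigr => i _.
rewrite (derZ D) (derM D) /yv /xv !K_act_var -(hc i) -!mul_mpolyC rmorphD /=.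
by ring.
Qed.

Lemma in_K_sum (h : 'rV[k]_(n + n)) : in_K h ->
  exists c, forall i, h 0 (lshift n i) + h 0 (rshift n i) = c.
Proof.
(* For [n = 0] there is no index to read [c] from, and any value works. *)
move=> hK; case: (pickP (fun _ : 'I_n => true)) => [i _|no_i].
  by exists (h 0 (lshift n i) + h 0 (rshift n i)) => j.
by exists 0 => i; have := no_i i.
Qed.

(** * Regular elements modulo a [K]-prime Poisson ideal *)

Section KPrime.
Variable I : A -> Prop.
Hypothesis primeI : K_prime_poisson_ideal Gamma P Q I.

Let idI : is_ideal I. Proof. by case: primeI => -[]. Qed.

Let brI f g : I f -> I (br f g).
Proof. by case: primeI => -[_ H] _ _ _; apply: H. Qed.

Let brIr f g : I f -> I (br g f).
Proof. by move=> If; rewrite bracketC //; apply: idealN => //; apply: brI. Qed.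

Let KI h f : in_K h -> I f -> I (K_act h f).
Proof. by case: primeI => _ _ H _ hK; apply: H. Qed.

(* K-primeness makes [v] regular modulo [I]: the product of the Poisson ideals
   [I + (v)] and [(I : v)] is contained in [I]. *)
Lemma normal_regular v :
  (forall a, exists c, I (br v 'X_a - c * v)) ->
  (forall h, in_K h -> exists c, K_act h v = c *: v) ->
  ~ I v -> forall f, I (v * f) -> I f.
Proof.
move=> brv Kv nIv.
(* Normality against the variables extends to every [g], since the bracket with [v] is a
   derivation. *)
have {}brv g : exists c, I (br v g - c * v).
  rewrite bracket_sumr; elim: (index_enum _) => [|b r [c IH]].
    by exists 0; rewrite big_nil mul0r subr0; apply: ideal0.
  have [d Hd] := brv b; exists (g^`M(b) * d + c).
  rewrite big_cons; set s := \sum_(_ <- _) _ in IH *.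
  have -> : g^`M(b) * br v 'X_b + s - (g^`M(b) * d + c) * v =
    g^`M(b) * (br v 'X_b - d * v) + (s - c * v) by ring.
  by apply: idealD => //; apply: idealM.
pose I1 f := exists c, I (f - c * v).
pose I2 f := I (v * f).
have [_ _ _ /(_ I1 I2) pr] := primeI.
have idI1 : is_ideal I1.
  split; first by exists 0; rewrite mul0r subr0; apply: ideal0.
    move=> f g [c Hc] [d Hd]; exists (c + d).
    by rewrite mulrDl opprD addrACA; apply: idealD.
  move=> f g [c Hc]; exists (f * c).
  by rewrite -mulrA -mulrBr; apply: idealM.
have idI2 : is_ideal I2.
  split; rewrite /I2; first by rewrite mulr0; apply: ideal0.
    by move=> f g If Ig; rewrite mulrDr; apply: idealD.
  by move=> f g Ig; rewrite mulrCA; apply: idealM.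
case: pr => [|||||H|H //].
- split=> // f g [c Hc]; rewrite -(subrK (c * v) f) bracketDl.
  apply: idealD => //; first by exists 0; rewrite mul0r subr0; apply: brI.
  rewrite bracket_leibniz; apply: idealD; [by []|apply: idealM => //|].
  exists (br c g); rewrite mulrC subrr; exact: ideal0.
- move=> h hK f [c Hc]; have D := K_act_derivation h.
  rewrite -(subrK (c * v) f) (derD D) (derM D).
  have [d ->] := Kv h hK; exists (d *: c + K_act h c).
  rewrite (_ : _ - _ = K_act h (f - c * v)); first exact: KI.
  by rewrite -!mul_mpolyC; ring.
(* In [{v f, g} = v {f, g} + f {v, g}] the last term lies in [I], because [{v, g}] is a multiple of
   [v] modulo [I] and [v f] is in [I]. *)
- split=> // f g; rewrite /I2 => If; have [c Hc] := brv g.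
  have := brI g If; rewrite bracket_leibniz addrC; apply: idealDr => //.
  rewrite -[br v g](subrK (c * v)) mulrDr; apply: idealD => //.
    exact: idealM.
  by rewrite mulrCA (mulrC f); apply: idealM.
- move=> h hK f; rewrite /I2 => If; have D := K_act_derivation h.
  have := KI hK If; rewrite (derM D) addrC; have [c ->] := Kv h hK.
  apply: idealDr => //; rewrite -scalerAr mulrC; exact: idealZ.
- apply: ideal_gen_sub => // _ [a [b [[c Hc] Hb ->]]].
  rewrite -(subrK (c * v) a) mulrDl -mulrA; apply: idealD => //.
    by rewrite mulrC; apply: idealM.
  by apply: idealM.
- by case: nIv; apply: H; exists 1; rewrite mul1r subrr; apply: ideal0.
Qed.

Lemma W_regular m f : (m <= n)%N -> ~ I (W m) -> I (W m * f) -> I f.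
Proof.
move=> le_mn nIW; apply: normal_regular => // [a|h /in_K_sum [c hc]]; last first.
  by exists c; apply: K_act_W.
rewrite bracketC // (bracket_W _ le_mn); set e := sgn a * _.
exists (- (e *: 'X_a)); rewrite (_ : _ - _ = 0); first exact: ideal0.
by rewrite -!mul_mpolyC; ring.
Qed.

(** The only term that keeps ['X_a] from being normal is [W (idx a)], which vanishes modulo [I]. *)
Lemma var_regular a f : I (W (idx a)) -> ~ I 'X_a -> I ('X_a * f) -> I f.
Proof.
move=> IW nIa; apply: normal_regular => // [b|h _]; last first.
  by exists (h 0 a); apply: K_act_var.
exists (log_coef a b *: 'X_b); rewrite bracket_var_log -scalerAl (mulrC 'X_b).
rewrite addrAC subrr add0r; apply: idealM => //; exact: idealZ.
Qed.

Lemma var_mul_partner a :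
  'X_a * 'X_(partner a) = yv k (idx a) * xv k (idx a).
Proof.
elim/var_ind: a => i; rewrite /partner /idx ?split_l ?split_r //.
by rewrite mulrC.
Qed.

(** The bracket of ['X_a] with its partner is a multiple of ['X_a] plus or minus [W (idx a)], and
    the next [W] differs from this one by a multiple of ['X_a]. *)
Lemma var_W a : I 'X_a -> I (W (idx a)) /\ I (W (idx a).+1).
Proof.
move=> Ia.
have IW : I (W (idx a)).
  have := brI 'X_(partner a) Ia; rewrite bracket_var_log eqxx mul1r => H.
  apply/(idealZV idI (sgn_neq0 a))/(idealDr idI _ H).
  by apply: idealZ => //; rewrite mulrC; apply: idealM.
split=> //; rewrite WS; apply: idealD => //; apply: idealZ => //.
by rewrite -var_mul_partner mulrC; apply: idealM.
Qed.

Lemma mderivX_mul (m : 'X_{1..n + n}) b :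
  ('X_[m] : A)^`M(b) * 'X_b = (m b)%:R *: 'X_[m].
Proof.
rewrite mderivX -scalerAl -mpolyXD; case: (eqVneq (m b) 0%N) => [->|mb].
  by rewrite !scale0r.
by rewrite submK // lep1mP.
Qed.

Definition reduced (m : 'X_{1..n + n}) :=
  [forall a, (m a == 0%N) || (m (partner a) == 0%N)].

Lemma reducedP m a : reduced m -> m a = 0%N \/ m (partner a) = 0%N.
Proof. by move/forallP/(_ a)/orP => [] /eqP; [left|right]. Qed.

(* If [W (idx a)] is not in [I], the variable ['X_a] need not be normal modulo
   [I]; but the bracket with its partner turns a factor ['X_a] of a reduced
   monomial of [I] into the regular element [W (idx a)]. *)
Lemma monomial_notin m :
  reduced m -> (forall a, (0 < m a)%N -> ~ I 'X_a) -> ~ I 'X_[m].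
Proof.
have [d] := ubnP (mdeg m); elim: d m => // d IH m lt_md red_m avoid_m Im.
have [m0|[a ma]] : m = 0%MM \/ exists a, (0 < m a)%N.
  case: (pickP (fun a => 0 < m a)%N) => [a ma|m0]; first by right; exists a.
  left; apply/mnmP => a; rewrite mnm0E; apply/eqP.
  by rewrite eqn0Ngt m0.
  by case: primeI => _ nI1 _ _; apply: nI1; rewrite -mpolyX0 -m0.
have Em : m = (m - U_(a) + U_(a))%MM by rewrite submK // lep1mP -lt0n.
have le_m' b : ((m - U_(a))%MM b <= m b)%N by rewrite mnmBE leq_subr.
apply: (IH (m - U_(a))%MM).
- by move: lt_md; rewrite {1}Em mdegD mdeg1 addn1 ltnS.
- apply/forallP => b; case: (reducedP b red_m) => mb; apply/orP; [left|right];
  by rewrite -leqn0 -mb.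
- by move=> b mb; apply: avoid_m; apply: leq_trans mb _.
have [IW|nIW] := classic (I (W (idx a))).
  apply: (var_regular IW); first exact: avoid_m.
  by rewrite mulrC -mpolyXD -Em.
apply: (W_regular _ nIW); first exact: ltnW.
(* Only the derivative in ['X_a] brings in the extra term of the bracket; the summands of [rest] are
   multiples of ['X_[m]]. *)
have := brIr 'X_(partner a) Im; rewrite bracket_sumr (bigD1 a) //=.
set rest := \sum_(b | _) _ => H.
have Irest : I rest.
  apply: (big_ind I); [exact: ideal0|exact: idealD|move=> b ba].
  rewrite bracket_var_log partnerK (negPf ba) mul0r addr0 -scalerAr.
  apply: idealZ => //; rewrite mulrCA; apply: idealM => //.
  by rewrite mderivX_mul; apply: idealZ.
move: H; rewrite addrC => /(idealDr idI Irest).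
rewrite bracket_var_log partnerK eqxx mul1r idx_partner mulrDr.
have I1 : I ('X_[m]^`M(a) * (log_coef (partner a) a *: ('X_(partner a) * 'X_a))).
  rewrite -scalerAr mulrCA mderivX_mul; apply: idealZ => //.
  by apply: idealM => //; apply: idealZ.
move/(idealDr idI I1); rewrite -scalerAr => /(idealZV idI (sgn_neq0 _)).
(* The derivative contributes the scalar [m a], which is invertible in characteristic zero. *)
rewrite mderivX -scalerAl => /idealZV; rewrite mulrC; apply=> //.
by rewrite natr_char0_eq0 // -lt0n.
Qed.

(** * Products of monomials and powers of the [Omega] *)

Local Notation index := ('X_{1..n + n} * 'X_{1..n})%type.

Definition basis (s : index) : A :=
  'X_[s.1] * \prod_i Omega P Q i ^+ s.2 i.

Definition good (s : index) : Prop :=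
  [/\ reduced s.1, forall a, (0 < s.1 a)%N -> ~ I 'X_a
    & forall i, (0 < s.2 i)%N -> ~ I (Omega P Q i)].

(** The factors [Omega i] that occur are outside [I], hence regular modulo [I]; cancelling them
    leaves the reduced monomial. *)
Lemma basis_notin s : good s -> ~ I (basis s).
Proof.
case=> red_s var_s Om_s; rewrite /basis => Is.
apply: (monomial_notin red_s var_s); move: Is.
(* The property carried through the product is regularity modulo [I], which is multiplicative. *)
apply: (big_ind (fun G => forall f, I (f * G) -> I f)) 'X_[_] => [f|G H IG IH f|i _].
- by rewrite mulr1.
- by rewrite mulrA => /IH /IG.
case: (posnP (s.2 i)) => [->|/Om_s nI] f; first by rewrite mulr1.
elim: (s.2 i) f => [|e IHe] f; first by rewrite mulr1.
rewrite exprS mulrCA => /(W_regular (ltn_ord i) nI); exact: IHe.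
Qed.

Lemma basisD1 s i : basis (s.1, s.2 + U_(i))%MM = Omega P Q i * basis s.
Proof.
rewrite /basis mulrCA /=; congr (_ * _).
rewrite (bigD1 i) //= [in RHS](bigD1 i) //= mnmDE mnm1E eqxx addn1 exprS mulrA.
congr (_ * _); apply: eq_bigr => j ji.
by rewrite mnmDE mnm1E eq_sym (negPf ji) addn0.
Qed.

Lemma basisMX d s : basis (s.1 + d, s.2)%MM = 'X_[d] * basis s.
Proof. by rewrite /basis /= mpolyXD mulrA (mulrC 'X_[d]). Qed.

(** * Eigenvalues of the products and their separation *)

Definition weight (h : 'rV[k]_(n + n)) (c : k) (s : index) : k :=
  \sum_a (s.1 a)%:R * h 0 a + \sum_i (s.2 i)%:R * c.

Lemma K_act_basis (h : 'rV[k]_(n + n)) c s :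
  (forall i, h 0 (lshift n i) + h 0 (rshift n i) = c) ->
  K_act h (basis s) = weight h c s *: ('X_[0] * basis s).
Proof.
move=> hc; have D := K_act_derivation h; rewrite mpolyX0 /basis (mpolyXE_id _ s.1).
apply: (der_eigenM D); apply: (der_eigen_prod D) => i _; rewrite mul1r.
  exact: K_act_var.
by rewrite OmegaE; apply: K_act_W.
Qed.

Definition bracket_weight (a : 'I_(n + n)) (s : index) : k :=
  \sum_b (s.1 b)%:R * log_coef a b + \sum_i (s.2 i)%:R *
    (sgn a * (if (idx a <= i)%N then Q 0 (idx a) else P 0 (idx a))).

(** With the partner of ['X_a] absent from the monomial, the extra term [W (idx a)] never arises. *)
Lemma bracket_basis a (s : index) : s.1 (partner a) = 0%N ->
  br 'X_a (basis s) = bracket_weight a s *: ('X_a * basis s).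
Proof.
move=> sa; have D := bracket_derivation 'X_a; rewrite /basis (mpolyXE_id _ s.1).
apply: (der_eigenM D); apply: (der_eigen_prod D) => b sb.
  rewrite bracket_var_log; case: eqVneq sb => [->|_ _]; first by rewrite sa.
  by rewrite mul0r addr0.
by rewrite OmegaE bracket_W // ltnS.
Qed.

(** The element of [K] with entries 1 at [y_i] and -1 at [x_i] reads off the difference of their
    exponents. In a reduced monomial one of the two is zero, so the difference determines both. *)
Lemma weight_inj (s t : index) : reduced s.1 -> reduced t.1 ->
  (forall (h : 'rV[k]_(n + n)) c,
    (forall i, h 0 (lshift n i) + h 0 (rshift n i) = c) ->
    weight h c s = weight h c t) ->
  s.1 = t.1 /\ \sum_i ((s.2 i)%:R : k) = \sum_i (t.2 i)%:R.
Proof.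
move=> red_s red_t eq_w.
have E1 : s.1 = t.1.
  suff Hi i : s.1 (lshift n i) = t.1 (lshift n i) /\
              s.1 (rshift n i) = t.1 (rshift n i).
    by apply/mnmP; elim/var_ind => i; case: (Hi i).
  pose h : 'rV[k]_(n + n) := \row_a ((a == lshift n i)%:R - (a == rshift n i)%:R).
  have wh u : weight h 0 u = (u.1 (lshift n i))%:R - (u.1 (rshift n i))%:R.
    rewrite /weight [X in _ + X]big1 => [|j _]; last by rewrite mulr0.
    rewrite addr0 (bigD1 (lshift n i)) // (bigD1 (rshift n i)) ?eq_rlshift //=.
    rewrite big1 => [|a /andP[/negPf al /negPf ar]]; last first.
      by rewrite mxE al ar subrr mulr0.
    by rewrite !mxE !eqxx eq_rlshift eq_lrshift subr0 sub0r mulr1 mulrN1 addr0.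
  have hc j : h 0 (lshift n j) + h 0 (rshift n j) = 0.
    rewrite !mxE eq_rlshift eq_lrshift subr0 sub0r.
    by rewrite (inj_eq (@lshift_inj _ _)) (inj_eq (@rshift_inj _ _)) subrr.
  have := eq_w h 0 hc; rewrite !wh => H.
  have {H} : (s.1 (lshift n i) + t.1 (rshift n i) =
    t.1 (lshift n i) + s.1 (rshift n i))%N.
    apply: (natr_char0_inj char0); rewrite !natrD; apply/eqP.
    rewrite -subr_eq0 (_ : _ - _ = ((s.1 (lshift n i))%:R - (s.1 (rshift n i))%:R)
      - ((t.1 (lshift n i))%:R - (t.1 (rshift n i))%:R)); last by ring.
    by rewrite H subrr.
  have := reducedP (lshift n i) red_s; have := reducedP (lshift n i) red_t.
  by rewrite /partner split_l => -[] -> [] ->; lia.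
split=> //.
(* The constant one half gives every pair sum 1, so each factor [Omega] counts once. *)
have := eq_w (const_mx (2^-1)) 1 _; rewrite /weight E1 => H.
under eq_bigr do rewrite -[_%:R]mulr1.
under [RHS]eq_bigr do rewrite -[_%:R]mulr1.
apply: (addrI _ (H _)) => i; rewrite !mxE -mulr2n -[LHS]mulr_natr mulVf //.
by rewrite natr_char0_eq0.
Qed.

Lemma subPQ_neq0 i : Q 0 i - P 0 i != 0.
Proof. by rewrite subr_eq0 eq_sym; apply/eqP/neqPQ. Qed.

Lemma exists_variable (m : 'X_{1..n + n}) j :
  reduced m -> exists a, idx a = j /\ m (partner a) = 0%N.
Proof.
move=> red_m; case: (reducedP (lshift n j) red_m) => mj.
  by exists (rshift n j); move: mj; rewrite /idx /partner split_r.
by exists (lshift n j); rewrite mj /idx split_l.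
Qed.

(** Writing [Q] as [P + (Q - P)], the part in [P] cancels because the total exponents agree. The
    part in [Q - P] runs over [i >= idx a], where only [i = idx a] can contribute. *)
Lemma bracket_weight_sub (a : 'I_(n + n)) (s t : index) : s.1 = t.1 ->
  \sum_i ((s.2 i)%:R : k) = \sum_i (t.2 i)%:R ->
  (forall i : 'I_n, (idx a < i)%N -> s.2 i = t.2 i) ->
  bracket_weight a s - bracket_weight a t = sgn a *
    (((s.2 (idx a))%:R - (t.2 (idx a))%:R) * (Q 0 (idx a) - P 0 (idx a))).
Proof.
move=> E1 E2 gt_eq; set j := idx a; pose d i : k := (s.2 i)%:R - (t.2 i)%:R.
have d0 : \sum_i d i = 0 by rewrite sumrB E2 subrr.
rewrite /bracket_weight E1 opprD addrACA subrr add0r -sumrB -/j.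
transitivity (sgn a * (P 0 j * \sum_i d i +
  \sum_i d i * (if (j <= i)%N then Q 0 j - P 0 j else 0))).
  rewrite mulr_sumr -big_split mulr_sumr; apply: eq_bigr => i _ /=.
  by rewrite /d; case: leqP => _; ring.
rewrite d0 mulr0 add0r (bigD1 j) //= leqnn big1 ?addr0 // => i ij.
case: leqP => [le_ji|_]; last by rewrite mulr0.
rewrite /d gt_eq ?subrr ?mul0r // ltn_neqAle le_ji andbT.
by rewrite eq_sym.
Qed.

(** If [K] does not already separate [s] from some member of [S], all members share their monomial
    and total exponent, and a bracket with a suitable variable separates [s] from [t]. The shift [d]
    records the factor that this bracket introduces. *)
Lemma separation (S : seq index) (s t : index) :
  (forall u, u \in S -> good u) -> s \in S -> t \in S -> s != t ->
  exists D d lam, [/\ is_derivation D, forall f, I f -> I (D f),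
    exists2 u, u \in S & lam u != lam s :> k
    & forall u, u \in S ->
        D (basis u) = lam u *: ('X_[d] * basis u) /\ good (u.1 + d, u.2)%MM].
Proof.
move=> goodS Ss St s_t.
have [[h [c [u [hc Su wu]]]]|no_weight] := classic (exists (h : 'rV[k]_(n + n)) c u,
    [/\ forall i, h 0 (lshift n i) + h 0 (rshift n i) = c, u \in S
      & weight h c u != weight h c s]).
  exists (K_act h), 0%MM, (weight h c); split.
  - exact: K_act_derivation.
  - by move=> f; apply: KI => i j; rewrite !hc.
  - by exists u.
  - move=> v Sv; split; first exact: K_act_basis.
    by rewrite addm0; case: v Sv => v1 v2 /goodS.
have red u : u \in S -> reduced u.1 by case/goodS.
have same u : u \in S ->
    u.1 = s.1 /\ \sum_i ((u.2 i)%:R : k) = \sum_i (s.2 i)%:R.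
  move=> Su; apply: weight_inj; [exact: red|exact: red|move=> h c hc].
  by apply/eqP/negPn/negP => wu; apply: no_weight; exists h, c, u.
have [i0 i0P] : exists i0, t.2 i0 != s.2 i0.
  apply/existsP; apply: contraR s_t => /existsPn H.
  have [E1 _] := same t St.
  rewrite [s]surjective_pairing [t]surjective_pairing E1; apply/eqP.
  congr (_, _); apply/mnmP => i; apply/esym/eqP.
  by have := H i; rewrite negbK.
(* Taking the largest index of disagreement makes the exponents agree beyond [j], as
   [bracket_weight_sub] needs. *)
case: (@arg_maxnP _ i0 (fun i => t.2 i != s.2 i) val i0P) => j tj max_j.
have [a [aj sa]] := exists_variable j (red s Ss).
(* Otherwise [Omega j] would lie in [I], although it occurs in one of the good products [s] and
   [t]. *)
have nIa : ~ I 'X_a.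
  case/var_W; rewrite aj => _ IOm.
  have [_ _ /(_ j) H] := goodS s Ss; have [_ _ /(_ j) H'] := goodS t St.
  case: (posnP (s.2 j)) => [s0|/H //].
  by case: (posnP (t.2 j)) => [t0|/H' //]; rewrite s0 t0 eqxx in tj.
exists (br 'X_a), U_(a)%MM, (bracket_weight a); split.
- exact: bracket_derivation.
- by move=> f; apply: brIr.
- exists t => //; rewrite -subr_eq0; have [E1 E2] := same t St.
  rewrite bracket_weight_sub // aj => [|i ji]; last first.
    by apply/eqP/negPn/negP => /max_j /=; rewrite leqNgt ji.
  rewrite !mulf_neq0 ?sgn_neq0 ?subPQ_neq0 // subr_eq0.
  by apply: contra tj => /eqP /(natr_char0_inj char0) ->.
- move=> u Su; have [E1 _] := same u Su.
  split; first by rewrite bracket_basis ?E1.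
  have [_ var_u Om_u] := goodS u Su; split=> //= [|b].
    (* Multiplication by ['X_a] keeps the monomial reduced because its partner does not occur. *)
    apply/forallP => b; rewrite E1 !mnmDE !mnm1E.
    have [<-|ab] := eqVneq a b; first
      by rewrite sa [a == _]eq_sym (negPf (partner_neq a)) orbT.
    have [ab'|_] := eqVneq a (partner b); last first.
      by rewrite /= !addn0; apply: (forallP (red s Ss)).
    by rewrite -[b]partnerK -ab' sa.
  by rewrite mnmDE mnm1E; have [<- _|_] := eqVneq a b; rewrite ?addn0 //; apply: var_u.
Qed.

(** * Combinations of good products in the ideal *)

Lemma good_combination_eq0 (l : seq (k * index)) :
  uniq [seq u.2 | u <- l] -> (forall u, u \in l -> u.1 != 0 /\ good u.2) ->
  I (\sum_(u <- l) u.1 *: basis u.2) -> l = [::].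
Proof.
have [N] := ubnP (size l); elim: N l => // N IH [//|u [|v l]] lt_l uniq_l good_l.
  rewrite big_seq1; have [u0 gu] := good_l u (mem_head _ _).
  by move/(idealZV idI u0)/(basis_notin gu).
set L := u :: v :: l in lt_l uniq_l good_l * => IL.
have LP w : w \in [seq w.2 | w <- L] -> good w.
  by case/mapP => x /good_l [_ gx] ->.
have uL : u.2 \in [seq w.2 | w <- L] by rewrite inE eqxx.
have vL : v.2 \in [seq w.2 | w <- L] by rewrite !inE eqxx orbT.
have uv : u.2 != v.2 by move: uniq_l => /= /andP[]; rewrite inE negb_or => /andP[].
have [D [d [lam [derD_ DI [w wL lam_w] Dbasis]]]] := separation LP uL vL uv.
(* Subtracting [lam u.2] times ['X_[d]] from [D] kills the term of [u], so [L'] lists a shorter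
   combination in [I]. *)
pose shift (x : k * index) : k * index :=
  ((lam x.2 - lam u.2) * x.1, (x.2.1 + d, x.2.2)%MM).
pose L' := [seq shift x | x <- L & lam x.2 != lam u.2].
(* The term of [w] survives in [L'], so an empty [L'] is absurd. *)
suff : L' = [::].
  case/mapP: wL lam_w => x Lx -> lam_x L'0.
  have : shift x \in L' by apply: map_f; rewrite mem_filter lam_x.
  by rewrite L'0.
apply: IH.
- rewrite size_map size_filter /= eqxx add0n; move: lt_l => /=; rewrite !ltnS.
  apply: leq_ltn_trans; exact: (count_size _ (v :: l)).
- rewrite -map_comp (eq_map (g := (fun s => (s.1 + d, s.2)%MM) \o snd)) //.
  rewrite map_comp map_inj_uniq; last first.
    apply: (can_inj (g := fun s : index => (s.1 - d, s.2)%MM)) => -[s1 s2] /=.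
    by rewrite addmK.
  apply: (subseq_uniq _ uniq_l); apply: map_subseq; exact: filter_subseq.
- move=> y /mapP[x]; rewrite mem_filter => /andP[lam_x Lx] -> /=.
  have [x0 _] := good_l x Lx; rewrite mulf_neq0 ?subr_eq0 //; split=> //.
  by case: (Dbasis x.2 (map_f _ Lx)).
have -> : \sum_(x <- L') x.1 *: basis x.2 = D (\sum_(x <- L) x.1 *: basis x.2)
    - lam u.2 *: ('X_[d] * \sum_(x <- L) x.1 *: basis x.2).
  rewrite (der_sum derD_) mulr_sumr scaler_sumr -sumrB big_map big_filter.
  rewrite big_mkcond /= big_seq [RHS]big_seq; apply: eq_bigr => x Lx.
  rewrite (derZ derD_) basisMX; have [-> _] := Dbasis x.2 (map_f _ Lx).
  by case: eqVneq => [->|_] /=; rewrite -!mul_mpolyC ?rmorphM ?rmorphB /=; ring.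
apply: idealB => //; first exact: DI.
by apply: idealZ => //; apply: idealM.
Qed.

(** * Reduction modulo the candidate generators *)

Let T (f : A) := calP P Q f /\ I f.

Let idT : is_ideal (ideal_gen T). Proof. exact: ideal_gen_ideal. Qed.

Let Tvar a : I 'X_a -> T 'X_a.
Proof.
move=> Ia; split=> //; elim/var_ind: a {Ia} => i; exists i; first by constructor 2.
by constructor 3.
Qed.

Let TOmega i : I (Omega P Q i) -> T (Omega P Q i).
Proof. by move=> Ii; split=> //; exists i; constructor. Qed.

Let spanned f := exists2 l : seq (k * index), (forall u, u \in l -> good u.2)
  & ideal_gen T (f - \sum_(u <- l) u.1 *: basis u.2).

Let spanned0 f : ideal_gen T f -> spanned f.
Proof. by exists [::] => //; rewrite big_nil subr0. Qed.

Let spannedD f g : spanned f -> spanned g -> spanned (f + g).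
Proof.
case=> [l gl Tl] [l' gl' Tl']; exists (l ++ l').
  by move=> u; rewrite mem_cat => /orP[/gl|/gl'].
by rewrite big_cat /= opprD addrACA; apply: idealD.
Qed.

Let spannedZ c f : spanned f -> spanned (c *: f).
Proof.
case=> l gl Tl; exists [seq (c * u.1, u.2) | u <- l].
  by move=> _ /mapP[u /gl gu ->].
rewrite big_map (eq_bigr (fun u => c *: (u.1 *: basis u.2))) => [|u _].
  by rewrite -scaler_sumr -scalerBr; apply: idealZ.
by rewrite scalerA.
Qed.

(** Induction on the degree of the monomial. A factor [y_i x_i] is replaced by a multiple of
    [Omega i] minus its predecessor, which lowers that degree by two. A reduced product that is not
    good has a factor in [T]. *)
Let spanned_basis s : spanned (basis s).
Proof.
have [N] := ubnP (mdeg s.1); elim: N s => // N IH s lt_s.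
have [red_s|] := boolP (reduced s.1).
  have [gs|ngs] := classic (good s).
    exists [:: (1, s)]; first by move=> u; rewrite inE => /eqP ->.
    by rewrite big_seq1 scale1r subrr; apply: ideal0.
  apply: spanned0; apply: NNPP => nTs; apply: ngs; split=> // [a sa Ia|i si Ii].
    apply: nTs; rewrite /basis mulrC; apply: idealM => //.
    rewrite -[s.1](@submK _ U_(a)) ?lep1mP -?lt0n // mpolyXD.
    by apply: idealM => //; apply: mem_ideal_gen; apply: Tvar.
  apply: nTs; rewrite /basis; apply: idealM => //.
  rewrite (bigD1 i) //= mulrC; apply: idealM => //.
  by rewrite -(prednK si) exprSr; apply: idealM => //; apply: mem_ideal_gen; apply: TOmega.
rewrite /reduced negb_forall => /existsP[a]; rewrite negb_or => /andP[sa spa].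
pose t : index := (s.1 - U_(a) - U_(partner a), s.2)%MM.
have Es1 : s.1 = (t.1 + U_(a) + U_(partner a))%MM.
  rewrite -addmA (addmC U_(a)%MM) addmA /t /= submK ?submK ?lep1mP //.
  by rewrite mnmBE mnm1E [a == _]eq_sym (negPf (partner_neq a)) subn0.
have lt_t : (mdeg t.1 < N)%N.
  move: lt_s; rewrite Es1 !mdegD !mdeg1 !addn1 ltnS; exact: leq_ltn_trans.
have Es : basis s = (Q 0 (idx a) - P 0 (idx a))^-1 *:
    (Omega P Q (idx a) * basis t - W (idx a) * basis t).
  have -> : basis s = yv k (idx a) * xv k (idx a) * basis t.
    rewrite -var_mul_partner /basis Es1 !mpolyXD.
    rewrite (mulrC _ (\prod_i _)) mulrC; rewrite -!mulrA.
    by rewrite !(mulrCA 'X_(partner a)) ?(mulrCA 'X_a) mulrC !mulrA.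
  rewrite OmegaE WS -mulrBl [W _ + _]addrC addrK -scalerAl scalerA.
  by rewrite mulVf ?scale1r // subPQ_neq0.
rewrite Es; apply: spannedZ; apply: spannedD; first by rewrite -basisD1; apply: IH.
(* At the first index there is no preceding [Omega], and the subtracted term is zero. *)
rewrite -scaleN1r; apply: spannedZ; case: (W_pred (idx a)) => [[_ ->]|[j [_ ->]]].
  by rewrite mul0r; apply: spanned0; exact: (ideal0 idT).
by rewrite -basisD1; apply: IH.
Qed.

(** Merging equal indices and dropping zero coefficients meets the conditions of
    [good_combination_eq0]. *)
Lemma collect_terms (l : seq (k * index)) :
  (forall u, u \in l -> good u.2) -> exists l', [/\ uniq [seq u.2 | u <- l'],
    forall u, u \in l' -> u.1 != 0 /\ good u.2
    & \sum_(u <- l) u.1 *: basis u.2 = \sum_(u <- l') u.1 *: basis u.2].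
Proof.
move=> gl; pose c s : k := \sum_(u <- l | u.2 == s) u.1.
pose S := undup [seq u.2 | u <- l].
exists [seq (c s, s) | s <- S & c s != 0]; split.
- by rewrite -map_comp (eq_map (g := id)) // map_id filter_uniq ?undup_uniq.
- move=> u' /mapP[s]; rewrite mem_filter mem_undup => /andP[cs /mapP[u /gl gu Es]].
  by move=> -> /=; split=> //; rewrite Es.
rewrite big_map big_filter [RHS]big_mkcond.
transitivity (\sum_(s <- S) c s *: basis s); last first.
  by apply: eq_bigr => s _; case: (eqVneq (c s) 0) => //= ->; rewrite scale0r.
under [RHS]eq_bigr do rewrite scaler_suml.
rewrite (exchange_big_dep predT) //= big_seq [RHS]big_seq.
apply: eq_bigr => u lu; rewrite -big_filter.
rewrite (eq_filter (a2 := pred1 u.2)) => [|s]; last by rewrite eq_sym.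
rewrite filter_pred1_uniq ?undup_uniq ?big_seq1 // mem_undup; exact: map_f.
Qed.

(** Modulo the ideal of [T], which is contained in [I], [f] is a combination of good products. That
    combination lies in [I], so it has no terms. *)
Lemma K_prime_generated f : I f -> ideal_gen T f.
Proof.
move=> If; have [l gl Tl] : spanned f.
  rewrite (mpolyE f); elim: (msupp f) => [|m r IH].
    by rewrite big_nil; apply: spanned0; exact: (ideal0 idT).
  rewrite big_cons; apply: spannedD => //; apply: spannedZ.
  have := spanned_basis (m, 0%MM); rewrite /basis /= big1 ?mulr1 // => i _.
  by rewrite mnm0E expr0.
have [l' [uniq_l' gl' El]] := collect_terms gl.
have : I (\sum_(u <- l) u.1 *: basis u.2).
  rewrite -(subKr f (\sum_(u <- l) _)); apply: idealB => //.
  by apply: ideal_gen_sub Tl => // g [].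
rewrite El => /(good_combination_eq0 uniq_l' gl') l'0.
by move: Tl; rewrite El l'0 big_nil subr0.
Qed.

(** * Admissibility of the generators *)

Lemma var_or (i : 'I_n) : I (W i) -> I (W i.+1) -> I (yv k i) \/ I (xv k i).
Proof.
move=> IW; rewrite WS => /(idealDr idI IW) /(idealZV idI (subPQ_neq0 i)) Iyx.
have [|nIy] := classic (I (yv k i)); [by left|right].
by apply: (@var_regular (lshift n i)) => //; rewrite /idx split_l.
Qed.

Lemma W_of_var (i : 'I_n) :
  I (yv k i) \/ I (xv k i) -> I (W i) /\ I (W i.+1).
Proof. by case=> /var_W; rewrite /idx ?split_l ?split_r. Qed.

(** In terms of [W] both clauses of admissibility are one equivalence, for [W i] and [W i.+1]; the
    clause for the first index arises from [W 0 = 0]. *)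
Lemma K_prime_admissible : admissible P Q T.
Proof.
have Tyx (i : 'I_n) : T (yv k i) \/ T (xv k i) -> I (W i) /\ I (W i.+1).
  by case=> -[_ Ia]; apply: W_of_var; [left|right].
have yxT (i : 'I_n) : I (W i) -> I (W i.+1) -> T (yv k i) \/ T (xv k i).
  by move=> IW IW1; case: (var_or IW IW1) => Ia; [left|right]; apply: Tvar.
split=> [f []//|i j ij|i i0]; split.
- by case/Tyx => IW IW1; split; apply: TOmega; rewrite // OmegaE -ij.
- by case=> -[_ IOi] [_ IOj]; apply: yxT; rewrite // ij.
- by case/Tyx => _; apply: TOmega.
- by case=> _ IO; apply: yxT; rewrite // i0 W0; apply: ideal0.
Qed.

End KPrime.
End Poisson.

Theorem theorem3p8 (k : closedFieldType) (char0 : [pchar k] =i pred0) (n : nat)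
    (Gamma : 'M[k]_n) (P Q : 'rV[k]_n)
    (skew : Gamma^T = - Gamma) (neqPQ : forall i : 'I_n, P 0 i <> Q 0 i)
    (I : {mpoly k[n + n]} -> Prop) :
  K_prime_poisson_ideal Gamma P Q I ->
  exists T : {mpoly k[n + n]} -> Prop,
    admissible P Q T /\ (forall f, I f <-> ideal_gen T f).
Proof.
move=> primeI; exists (fun f => calP P Q f /\ I f); split.
  exact: (K_prime_admissible neqPQ primeI).
move=> f; split; first exact: (K_prime_generated char0 skew neqPQ primeI).
by apply: ideal_gen_sub => [|g []//]; case: primeI => -[].
Qed.
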